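(* Let $p>1$, $a,b\in\mathbb{R}$, $R\ge 1$, and let $(f,g)\in C_0^2(\mathbb{R})\times C_0^1(\mathbb{R})$ satisfy $\operatorname{supp} f,\ \operatorname{supp} g\subset\{x\in\mathbb{R}:|x|\le R\}$ and $$\int_{\mathbb{R}}g(x)\,dx>0.$$ Then there exist a constant $\varepsilon_2=\varepsilon_2(g,p,a,b,R)>0$ and a constant $C>0$ independent of $\varepsilon$ such that, for every $0<\varepsilon\le\varepsilon_2$, a function $v\in C(\mathbb{R}\times[0,T])$ (playing the role of $u_t$) with $$\operatorname{supp} v\subset\{(x,t)\in\mathbb{R}\times[0,T]:|x|\le t+R\}$$ that solves the integral equation $$v(x,t)=\varepsilon u_t^0(x,t)+L'_{a,b}(|v|^p)(x,t),\qquad (x,t)\in\mathbb{R}\times[0,T],$$ cannot exist whenever $T$ satisfies $$ T\ge \begin{cases} \exp\left(C\varepsilon^{-(p-1)}\right) & \text{if } a=0 \text{ and } b\ge -p,\\ \exp\left(C\varepsilon^{-p(p-1)}\right) & \text{if } a>0 \text{ and } p(1+a)+b=0,\\ C\varepsilon^{-(p-1)/(-a)} & \text{if } a<0 \text{ and } b\ge -p,\\ C\varepsilon^{-p(p-1)/(-p(1+a)-b)} & \text{if } p(1+a)+b<0 \text{ and } b<-p. \end{cases} $$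
   Context: For $x\in\mathbb{R}$, $\langle x\rangle:=\sqrt{1+x^2}$. $C_0^k(\mathbb{R})$ denotes the $C^k$ functions with compact support. The function $u_t^0$ (time derivative of the free wave with data $(f,g)$) is $$u_t^0(x,t)=\tfrac12\{f'(x+t)-f'(x-t)+g(x+t)+g(x-t)\}.$$ For a function $v=v(x,t)$, the linear operator $L'_{a,b}$ is $$ L'_{a,b}(v)(x,t):=\frac12\int_0^t\frac{v(x+t-s,s)}{\langle s+\langle x+t-s\rangle\rangle^{1+a}\langle s-\langle x+t-s\rangle\rangle^{1+b}}\,ds+\frac12\int_0^t\frac{v(x-t+s,s)}{\langle s+\langle x-t+s\rangle\rangle^{1+a}\langle s-\langle x-t+s\rangle\rangle^{1+b}}\,ds. $$ The integral equation is the one satisfied by $u_t$ when $u$ solves $u_{tt}-u_{xx}=|u_t|^p\langle t+\langle x\rangle\rangle^{-(1+a)}\langle t-\langle x\rangle\rangle^{-(1+b)}$ with $u(x,0)=\varepsilon f(x)$, $u_t(x,0)=\varepsilon g(x)$. *)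

(* Defs.v *)
From Stdlib Require Import Reals Lra.
From Coquelicot Require Import Coquelicot.
Open Scope R_scope.

(* Japanese bracket. *)
Definition jb (x : R) : R := sqrt (1 + x ^ 2).

(* [y ^ p] for [y >= 0] and [p > 0].  [Rpower] alone is wrong at the origin:
   [Rpower 0 p = exp (p * ln 0) = 1], since [ln 0 = 0]. *)
Definition rpow (y p : R) : R := if Req_dec_T y 0 then 0 else Rpower y p.

Definition closure {U : UniformSpace} (A : U -> Prop) (x : U) : Prop :=
  forall eps : posreal, exists y : U, ball x eps y /\ A y.

Definition supp {U : UniformSpace} (f : U -> R) : U -> Prop :=
  closure (fun x => f x <> 0).

(* Support of the restriction of [f] to [D], relative to [D]. *)
Definition supp_on {U : UniformSpace} (D : U -> Prop) (f : U -> R) (x : U) : Prop :=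
  D x /\ closure (fun y => D y /\ f y <> 0) x.

(* All orders [n <= k] are required: [Derive] is total, so [ex_derive_n f k]
   does not by itself force the lower derivatives to exist. *)
Definition C_k (k : nat) (f : R -> R) : Prop :=
  forall n : nat, (n <= k)%nat ->
    forall x : R, ex_derive_n f n x /\ continuous (Derive_n f n) x.

Definition C0_k (k : nat) (f : R -> R) : Prop := C_k k f /\ compact (supp f).

Definition int_line (g : R -> R) : R :=
  RInt_gen g (Rbar_locally m_infty) (Rbar_locally p_infty).

Definition ut0 (f g : R -> R) (x t : R) : R :=
  / 2 * (Derive f (x + t) - Derive f (x - t) + g (x + t) + g (x - t)).

Definition weight (a b x t : R) : R :=
  Rpower (jb (t + jb x)) (1 + a) * Rpower (jb (t - jb x)) (1 + b).

Definition L' (a b : R) (v : R * R -> R) (x t : R) : R :=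
  / 2 * RInt (fun s => v (x + t - s, s) / weight a b (x + t - s) s) 0 t
  + / 2 * RInt (fun s => v (x - t + s, s) / weight a b (x - t + s) s) 0 t.

Definition strip (T : R) (z : R * R) : Prop := 0 <= snd z <= T.

(* Main.v *)
Require Import Defs.
From Stdlib Require Import Reals Lra Psatz.
From Coquelicot Require Import Coquelicot.
Open Scope R_scope.

(** All four lifespan bounds come from one integral inequality: if
      [m t >= delta + c * int_{t0}^t |m s|^p s^(-1-k) ds] on [[t0, T]] with
    [k <= 0], then comparison with [N' = c N^p s^(-1-k)] forces
    [int_{t0}^T s^(-1-k) ds] to be at most of order [delta^(1-p)]
    ([blowup_bound]).  The integral is [ln (T / t0)] if [k = 0] and of order
    [T^(-k)] if [k < 0], which produces the exponential and the power type
    bounds on [T] ([lifespan_bound]).  There are two sources of such an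
    inequality, and the nonlinear terms being nonnegative, each of them may
    discard whatever it does not use.

    Near the light cone ([characteristic_inequality]; cases [a = 0] and
    [a < 0]): since [int g > 0] while [f'] has mean zero, [g - f'] is positive at
    some [y] ([profile_pos]).  Along [x - t = y] the free part of the solution
    remains of size [eps], and the weight is comparable to [t^(1+a)].  So
    [m t = v (y + t, t)] works with [delta] of order [eps] and [k = a].

    Inside the cone ([axis_inequality]; the cases where
    [kappa = p (1 + a) + b <= 0]): on the axis the free part is zero, and [v (0, t)]
    is half the integral of [|v|^p / weight] over the two characteristics that
    end at [(0, t)].  At time [s] these pass through the points [(x, s)] and
    [(-x, s)] with [x = t - s], where the weight is comparable to
    [t^(1+a) beta^(1+b)] with [beta = s - x].  Where they cross the boundary strip
    of the cone, the free wave gives a contribution of order [eps^p t^(-(1+a))].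
    Further inside, the values of [v] at [(x, s)] and [(-x, s)] add up to at
    least [v (0, beta)] ([axis_le_interior]), because the two characteristics
    that end at [(0, beta)] are initial pieces of characteristics that end at
    these two points.  So [m t = t^(1+a) v (0, t)] works with [delta] of order
    [eps^p] and [k = kappa].  Adding the two mirror images before estimating
    keeps the inequality closed in terms of [v] on the axis alone, without any
    symmetry of the data. *)

(** * Real powers *)

Lemma Rpower_pos (x y : R) : 0 < Rpower x y.
Proof. apply exp_pos. Qed.

Lemma Rpower_le_base (x y q : R) :
  0 < x -> x <= y -> 0 <= q -> Rpower x q <= Rpower y q.
Proof. intros Hx Hxy Hq. now apply Rle_Rpower_l. Qed.

(** Exponents of either sign occur in the weight, so [Rpower _ q] need not be
    monotone; two-sided comparability of the bases survives nevertheless. *)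
Lemma Rpower_le_comparable (K y z q : R) :
  1 <= K -> 0 < y -> y <= K * z -> z <= K * y ->
  Rpower z q <= Rpower K (Rabs q) * Rpower y q.
Proof.
  intros HK Hy Hyz Hzy.
  assert (Hz : 0 < z) by nra.
  unfold Rpower. rewrite <- exp_plus.
  assert (H1 : ln z <= ln K + ln y).
  { rewrite <- ln_mult by lra. now apply Rcomplements.ln_le. }
  assert (H2 : ln y <= ln K + ln z).
  { rewrite <- ln_mult by lra. now apply Rcomplements.ln_le. }
  assert (H3 : q * ln z <= Rabs q * ln K + q * ln y).
  { unfold Rabs; destruct (Rcase_abs q); nra. }
  destruct H3 as [H3 | H3].
  - left; now apply exp_increasing.
  - right; now rewrite H3.
Qed.

Lemma continuous_Rpower_l (q x : R) :
  0 < x -> continuous (fun y => Rpower y q) x.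
Proof.
  intros Hx. unfold Rpower.
  apply continuous_exp_comp.
  apply (continuous_mult (fun _ => q) ln).
  - apply continuous_const.
  - apply (ex_derive_continuous ln). exists (/ x). now apply is_derive_ln.
Qed.

Lemma is_derive_Rpower (q x : R) :
  0 < x -> is_derive (fun y => Rpower y q) x (q * Rpower x (q - 1)).
Proof.
  intros Hx. apply is_derive_Reals. now apply derivable_pt_lim_power.
Qed.

Definition pabs (p y : R) : R := rpow (Rabs y) p.

Lemma pabs_pos (p y : R) : 0 < y -> pabs p y = Rpower y p.
Proof.
  intros Hy. unfold pabs, rpow. rewrite Rabs_pos_eq by lra.
  destruct (Req_dec_T y 0); [lra | reflexivity].
Qed.

Lemma pabs_0 (p : R) : pabs p 0 = 0.
Proof.
  unfold pabs, rpow. rewrite Rabs_R0.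
  destruct (Req_dec_T 0 0); [reflexivity | lra].
Qed.

Lemma pabs_abs (p y : R) : pabs p (Rabs y) = pabs p y.
Proof. unfold pabs. now rewrite Rabs_Rabsolu. Qed.

Lemma pabs_ge0 (p y : R) : 0 <= pabs p y.
Proof.
  unfold pabs, rpow. destruct (Req_dec_T (Rabs y) 0); [lra |].
  left; apply Rpower_pos.
Qed.

Lemma pabs_le (p y z : R) : 0 <= p -> 0 <= y -> y <= z -> pabs p y <= pabs p z.
Proof.
  intros Hp [Hy | <-] Hyz.
  - rewrite !pabs_pos by lra. now apply Rpower_le_base.
  - rewrite pabs_0. apply pabs_ge0.
Qed.

Lemma pabs_mult (p y z : R) :
  0 < y -> 0 <= z -> pabs p (y * z) = Rpower y p * pabs p z.
Proof.
  intros Hy [Hz | <-].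
  - rewrite !pabs_pos by nra. symmetry. now apply Rpower_mult_distr.
  - rewrite Rmult_0_r, pabs_0. ring.
Qed.

Lemma pabs_plus (p y z : R) :
  0 <= p -> 0 <= y -> 0 <= z ->
  pabs p (y + z) <= Rpower 2 p * (pabs p y + pabs p z).
Proof.
  intros Hp Hy Hz.
  assert (H : pabs p (y + z) <= Rpower 2 p * pabs p (Rmax y z)).
  { rewrite <- pabs_mult; [| lra |].
    - apply pabs_le; [easy | lra |].
      generalize (Rmax_l y z) (Rmax_r y z); lra.
    - generalize (Rmax_l y z); lra. }
  apply Rle_trans with (1 := H).
  apply Rmult_le_compat_l; [left; apply Rpower_pos |].
  generalize (pabs_ge0 p y) (pabs_ge0 p z).
  unfold Rmax; destruct (Rle_dec y z); lra.
Qed.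

Lemma continuous_pabs (p y : R) : 0 < p -> continuous (pabs p) y.
Proof.
  intros Hp.
  apply (continuous_ext (fun z => pabs p (Rabs z))).
  { intros z. apply pabs_abs. }
  destruct (Req_dec y 0) as [-> | Hy].
  - (* at the origin, [|z| < e ^ (1/p)] gives [|z| ^ p < e] *)
    apply filterlim_locally. intros e.
    assert (He : 0 < Rpower e (/ p)) by apply Rpower_pos.
    exists (mkposreal _ He). intros z Hz.
    change (Rabs (z - 0) < Rpower e (/ p)) in Hz.
    change (Rabs (pabs p (Rabs z) - pabs p (Rabs 0)) < e).
    rewrite Rabs_R0, pabs_0, Rminus_0_r in *.
    rewrite Rabs_pos_eq by apply pabs_ge0.
    destruct (Req_dec z 0) as [-> | Hz0].
    + rewrite Rabs_R0, pabs_0. apply cond_pos.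
    + assert (0 < Rabs z) by now apply Rabs_pos_lt.
      rewrite pabs_pos by easy.
      replace (pos e) with (Rpower (Rpower e (/ p)) p).
      * now apply Rlt_Rpower_l.
      * rewrite Rpower_mult, Rinv_l by lra. apply Rpower_1, cond_pos.
  - assert (Hy' : 0 < Rabs y) by now apply Rabs_pos_lt.
    apply (continuous_comp Rabs (pabs p)); [apply continuous_Rabs |].
    apply (continuous_ext_loc _ (fun z => Rpower z p)).
    + exists (mkposreal _ Hy'). intros z Hz.
      change (Rabs (z - Rabs y) < Rabs y) in Hz.
      apply Rabs_def2 in Hz. symmetry. apply pabs_pos. lra.
    + now apply continuous_Rpower_l.
Qed.

(** * The characteristic weight *)

Lemma jb_ge_abs (x : R) : Rabs x <= jb x.
Proof.
  unfold jb. rewrite <- sqrt_Rsqr_abs. apply sqrt_le_1_alt.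
  unfold Rsqr. nra.
Qed.

Lemma jb_ge_1 (x : R) : 1 <= jb x.
Proof.
  unfold jb. rewrite <- sqrt_1 at 1. apply sqrt_le_1_alt. nra.
Qed.

Lemma jb_le (x : R) : jb x <= 1 + Rabs x.
Proof.
  unfold jb. rewrite <- (sqrt_Rsqr (1 + Rabs x)) by (generalize (Rabs_pos x); lra).
  apply sqrt_le_1_alt. unfold Rsqr.
  generalize (Rabs_pos x) (pow2_abs x). nra.
Qed.

Lemma weight_pos (a b x t : R) : 0 < weight a b x t.
Proof. apply Rmult_lt_0_compat; apply Rpower_pos. Qed.

Lemma weight_even (a b x t : R) : weight a b (- x) t = weight a b x t.
Proof.
  unfold weight. replace (jb (- x)) with (jb x); [easy |].
  unfold jb. f_equal. ring.
Qed.

Lemma continuous_jb (x : R) : continuous jb x.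
Proof.
  unfold jb. apply (continuous_comp (fun y => 1 + y ^ 2) sqrt).
  - apply (ex_derive_continuous (fun y => 1 + y ^ 2)). auto_derive. easy.
  - apply continuous_sqrt.
Qed.

Lemma continuous_weight (a b : R) (z : R * R) :
  continuous (fun z => weight a b (fst z) (snd z)) z.
Proof.
  assert (Hjx : continuous (fun z : R * R => jb (fst z)) z).
  { apply (continuous_comp fst jb); [| apply continuous_jb].
    destruct z; apply continuous_fst. }
  assert (Ht : continuous (fun z : R * R => snd z) z).
  { destruct z; apply continuous_snd. }
  unfold weight.
  apply (continuous_mult (K := R_AbsRing)
    (fun z : R * R => Rpower (jb (snd z + jb (fst z))) (1 + a))
    (fun z : R * R => Rpower (jb (snd z - jb (fst z))) (1 + b))).
  - apply (continuous_comp (fun z : R * R => jb (snd z + jb (fst z)))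
             (fun y => Rpower y (1 + a))).
    + apply (continuous_comp (fun z : R * R => snd z + jb (fst z)) jb).
      * now apply (continuous_plus (V := R_NormedModule)
          (fun z : R * R => snd z) (fun z : R * R => jb (fst z))).
      * apply continuous_jb.
    + apply continuous_Rpower_l. generalize (jb_ge_1 (snd z + jb (fst z))); lra.
  - apply (continuous_comp (fun z : R * R => jb (snd z - jb (fst z)))
             (fun y => Rpower y (1 + b))).
    + apply (continuous_comp (fun z : R * R => snd z - jb (fst z)) jb).
      * now apply (continuous_minus (V := R_NormedModule)
          (fun z : R * R => snd z) (fun z : R * R => jb (fst z))).
      * apply continuous_jb.
    + apply continuous_Rpower_l. generalize (jb_ge_1 (snd z - jb (fst z))); lra.
Qed.

Lemma jb_outgoing_le (a x t : R) :
  0 <= t -> 1 <= t + Rabs x ->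
  Rpower (jb (t + jb x)) (1 + a)
  <= Rpower 3 (Rabs (1 + a)) * Rpower (t + Rabs x) (1 + a).
Proof.
  intros Ht Hx.
  generalize (jb_ge_abs x) (jb_le x) (jb_ge_1 x); intros H1 H2 H3.
  generalize (jb_ge_abs (t + jb x)) (jb_le (t + jb x)).
  rewrite Rabs_pos_eq by lra. intros H4 H5.
  apply Rpower_le_comparable; lra.
Qed.

(** Near the light cone the factor in [t - |x|] is bounded above and below,
    so only a power of [t + |x|] is left. *)
Lemma weight_cone_le (a b rho x t : R) :
  0 <= rho -> 0 <= t -> 1 <= t + Rabs x -> Rabs (t - Rabs x) <= rho ->
  weight a b x t
  <= Rpower 3 (Rabs (1 + a)) * Rpower (rho + 2) (Rabs (1 + b))
     * Rpower (t + Rabs x) (1 + a).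
Proof.
  intros Hr Ht Hx Hc. unfold weight.
  generalize (jb_outgoing_le a x t Ht Hx); intros H1.
  assert (H2 : Rpower (jb (t - jb x)) (1 + b) <= Rpower (rho + 2) (Rabs (1 + b))).
  { rewrite <- (Rmult_1_r (Rpower (rho + 2) _)).
    replace 1 with (Rpower 1 (1 + b)) at 3
      by (unfold Rpower; now rewrite ln_1, Rmult_0_r, exp_0).
    generalize (jb_ge_abs x) (jb_le x) (jb_ge_1 (t - jb x)) (jb_le (t - jb x)).
    intros H2 H3 H4 H5.
    assert (Rabs (t - jb x) <= rho + 1).
    { apply Rabs_le. apply Rabs_le_between in Hc. lra. }
    apply Rpower_le_comparable; try lra. nra. }
  replace (Rpower 3 (Rabs (1 + a)) * Rpower (rho + 2) (Rabs (1 + b))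
     * Rpower (t + Rabs x) (1 + a))
    with (Rpower 3 (Rabs (1 + a)) * Rpower (t + Rabs x) (1 + a)
     * Rpower (rho + 2) (Rabs (1 + b))) by ring.
  apply Rmult_le_compat; try easy; left; apply Rpower_pos.
Qed.

Lemma weight_interior_le (a b x t : R) :
  1 <= t - Rabs x ->
  weight a b x t
  <= Rpower 3 (Rabs (1 + a)) * Rpower 3 (Rabs (1 + b))
     * (Rpower (t + Rabs x) (1 + a) * Rpower (t - Rabs x) (1 + b)).
Proof.
  intros Hx. unfold weight.
  generalize (Rabs_pos x); intros H0.
  assert (H1 : Rpower (jb (t + jb x)) (1 + a)
    <= Rpower 3 (Rabs (1 + a)) * Rpower (t + Rabs x) (1 + a)).
  { apply jb_outgoing_le; lra. }
  assert (H2 : Rpower (jb (t - jb x)) (1 + b)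
    <= Rpower 3 (Rabs (1 + b)) * Rpower (t - Rabs x) (1 + b)).
  { generalize (jb_ge_abs x) (jb_le x) (jb_ge_1 (t - jb x))
      (jb_le (t - jb x)) (jb_ge_abs (t - jb x)).
    intros H2 H3 H4 H5 H6.
    assert (Rabs (t - jb x) <= t - Rabs x) by (apply Rabs_le; lra).
    generalize (Rle_abs (t - jb x)); intros H7.
    apply Rpower_le_comparable; lra. }
  replace (Rpower 3 (Rabs (1 + a)) * Rpower 3 (Rabs (1 + b))
     * (Rpower (t + Rabs x) (1 + a) * Rpower (t - Rabs x) (1 + b)))
    with ((Rpower 3 (Rabs (1 + a)) * Rpower (t + Rabs x) (1 + a))
     * (Rpower 3 (Rabs (1 + b)) * Rpower (t - Rabs x) (1 + b))) by ring.
  apply Rmult_le_compat; try easy; left; apply Rpower_pos.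
Qed.

(** * Integral inequality forcing blow-up *)

(** This is the comparison with [N' = c N^p s^(-1-k)].  The right-hand side [N]
    of the integral inequality is differentiable even if [m] is not, satisfies
    [N' >= c N^p s^(-1-k)], hence [N^(1-p) + (p-1) c Phi] decreases; positivity
    of [N^(1-p)] at the final time bounds the growth of [Phi]. *)
Lemma blowup_bound (p k c delta t0 T : R) (m Phi : R -> R) :
  1 < p -> 0 < c -> 0 < delta -> 0 < t0 <= T ->
  (forall t, 0 < t -> continuous m t) ->
  (forall t, 0 < t -> is_derive Phi t (Rpower t (- 1 - k))) ->
  (forall t, t0 <= t <= T ->
     delta + c * RInt (fun s => pabs p (m s) * Rpower s (- 1 - k)) t0 t <= m t) ->
  (p - 1) * c * (Phi T - Phi t0) < Rpower delta (1 - p).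
Proof.
  intros Hp Hc Hd HT Hm HPhi Hineq.
  set (h := fun s => pabs p (m s) * Rpower s (- 1 - k)) in *.
  assert (Hh : forall s, 0 < s -> continuous h s).
  { intros s Hs.
    apply (continuous_mult (fun s => pabs p (m s)) (fun s => Rpower s (- 1 - k))).
    - apply (continuous_comp m (pabs p)); [now apply Hm |].
      apply continuous_pabs. lra.
    - now apply continuous_Rpower_l. }
  assert (Hh0 : forall s, 0 <= h s).
  { intros s. apply Rmult_le_pos; [apply pabs_ge0 | left; apply Rpower_pos]. }
  assert (Hex : forall t, 0 < t -> ex_RInt h t0 t).
  { intros t Ht. apply (ex_RInt_continuous (V := R_CompleteNormedModule)).
    intros z Hz. apply Hh. apply Rlt_le_trans with (2 := proj1 Hz).
    apply Rmin_case; lra. }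
  set (N := fun t => delta + c * RInt h t0 t) in *.
  assert (HN : forall t, 0 < t -> is_derive N t (c * h t)).
  { intros t Ht. unfold N.
    replace (c * h t) with (0 + c * h t) by ring.
    apply (is_derive_plus (fun _ => delta) (fun t => c * RInt h t0 t)).
    - apply (is_derive_const (K := R_AbsRing) (V := R_NormedModule)).
    - apply (is_derive_scal (fun t => RInt h t0 t)).
      apply (is_derive_RInt (V := R_NormedModule) h (fun t => RInt h t0 t) t0).
      + exists (mkposreal t Ht). intros s Hs.
        change (Rabs (s - t) < t) in Hs. apply Rabs_def2 in Hs.
        apply (RInt_correct (V := R_CompleteNormedModule)). apply Hex. lra.
      + now apply Hh. }
  assert (HNpos : forall t, t0 <= t <= T -> delta <= N t).
  { intros t Ht. unfold N.
    assert (0 <= RInt h t0 t).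
    { apply RInt_ge_0; [lra | apply Hex; lra | intros; apply Hh0]. }
    nra. }
  set (G := fun t => Rpower (N t) (1 - p) + (p - 1) * c * Phi t).
  set (dG := fun t => c * h t * ((1 - p) * Rpower (N t) (1 - p - 1))
                      + (p - 1) * c * Rpower t (- 1 - k)).
  assert (HG : forall t, t0 <= t <= T -> is_derive G t (dG t)).
  { intros t Ht. unfold G, dG.
    assert (HNt := HNpos t Ht).
    apply (is_derive_plus (fun t => Rpower (N t) (1 - p))
             (fun t => (p - 1) * c * Phi t)).
    - apply (is_derive_comp (K := R_AbsRing) (V := R_NormedModule)
               (fun y => Rpower y (1 - p)) N).
      + apply is_derive_Rpower. lra.
      + apply HN. lra.
    - apply (is_derive_scal Phi). apply HPhi. lra. }
  assert (HdG : forall t, t0 <= t <= T -> dG t <= 0).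
  { intros t Ht. unfold dG.
    assert (HNt := HNpos t Ht).
    assert (Hmt : pabs p (N t) <= pabs p (m t)).
    { apply pabs_le; [lra | lra |]. now apply Hineq. }
    rewrite pabs_pos in Hmt by lra.
    assert (H1 : Rpower (N t) (1 - p - 1) * Rpower (N t) p = 1).
    { rewrite <- Rpower_plus. replace (1 - p - 1 + p) with 0 by ring.
      apply Rpower_O. lra. }
    assert (H2 := Rpower_pos (N t) (1 - p - 1)).
    assert (H3 := Rpower_pos t (- 1 - k)).
    assert (H4 : 1 <= Rpower (N t) (1 - p - 1) * pabs p (m t)) by nra.
    replace (c * h t * ((1 - p) * Rpower (N t) (1 - p - 1))
                      + (p - 1) * c * Rpower t (- 1 - k))
      with (- ((p - 1) * c * Rpower t (- 1 - k)
               * (Rpower (N t) (1 - p - 1) * pabs p (m t) - 1)))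
      by (unfold h; ring).
    assert (0 < (p - 1) * c) by nra.
    assert (0 < (p - 1) * c * Rpower t (- 1 - k)) by nra.
    nra. }
  assert (HGT : G T <= G t0).
  { destruct (MVT_gen G t0 T dG) as [s [Hs Heq]].
    - rewrite Rmin_left, Rmax_right by lra. intros x Hx. apply HG. lra.
    - rewrite Rmin_left, Rmax_right by lra. intros x Hx.
      apply continuity_pt_filterlim.
      apply (ex_derive_continuous G). exists (dG x). now apply HG.
    - rewrite Rmin_left, Rmax_right in Hs by lra.
      generalize (HdG s Hs). nra. }
  unfold G in HGT.
  assert (HN0 : N t0 = delta).
  { unfold N. rewrite RInt_point. unfold zero; simpl. ring. }
  rewrite HN0 in HGT.
  generalize (Rpower_pos (N T) (1 - p)). lra.
Qed.

(** For [delta = c1 * eps^q], a solution of the integral inequality on [[t0, T]]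
    would need [Phi T < Phi t0 + D * eps^(-q(p-1))] with
    [D = c1^(1-p) / ((p-1) c)].  As [eps <= 1], the term [Phi t0] is absorbed into
    the constant by taking [D + Phi t0] in place of [D]; the same choice makes
    [T >= t0]. *)
Lemma lifespan_bound (p k q c1 c t0 : R) :
  1 < p -> k <= 0 -> 0 <= q -> 0 < c1 -> 0 < c -> 1 <= t0 ->
  exists C, 0 < C /\ forall eps T, 0 < eps <= 1 ->
    (k = 0 /\ T >= exp (C * Rpower eps (- (q * (p - 1)))))
    \/ (k < 0 /\ T >= C * Rpower eps (- (q * (p - 1) / (- k)))) ->
    t0 <= T /\
    ~ exists m : R -> R,
        (forall t, 0 < t -> continuous m t) /\
        (forall t, t0 <= t <= T ->
           c1 * Rpower eps q
           + c * RInt (fun s => pabs p (m s) * Rpower s (- 1 - k)) t0 t <= m t).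
Proof.
  intros Hp Hk Hq Hc1 Hc Ht0.
  set (D := Rpower c1 (1 - p) / ((p - 1) * c)).
  assert (Hpc : 0 < (p - 1) * c) by nra.
  assert (HD : 0 < D) by (apply Rdiv_lt_0_compat; [apply Rpower_pos | easy]).
  (* size of the datum to the power [1 - p] *)
  assert (Hdelta : forall eps, 0 < eps ->
    Rpower (c1 * Rpower eps q) (1 - p)
    = (p - 1) * c * (D * Rpower eps (- (q * (p - 1))))).
  { intros eps He. rewrite <- Rpower_mult_distr; [| easy | apply Rpower_pos].
    rewrite Rpower_mult. replace (q * (1 - p)) with (- (q * (p - 1))) by ring.
    unfold D. field. lra. }
  assert (Hbig : forall eps, 0 < eps <= 1 -> 1 <= Rpower eps (- (q * (p - 1)))).
  { intros eps He. rewrite <- exp_0 at 1. unfold Rpower.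
    assert (0 <= - (q * (p - 1)) * ln eps).
    { assert (ln eps <= 0).
      { rewrite <- ln_1. apply Rcomplements.ln_le; lra. }
      assert (0 <= q * (p - 1)) by nra. nra. }
    destruct H as [H | H]; [left; now apply exp_increasing | right; now rewrite <- H]. }
  assert (Hln : 0 <= ln t0).
  { rewrite <- ln_1. apply Rcomplements.ln_le; lra. }
  destruct Hk as [Hk | Hk].
  - assert (Hnk : 0 < - k) by lra.
    (* here [Phi t = t^(-k) / (-k)], and everything is multiplied by [-k] *)
    set (S := Rpower t0 (- k) + (- k) * D).
    assert (HS : 0 < S).
    { unfold S. generalize (Rpower_pos t0 (- k)). nra. }
    exists (Rpower S (/ (- k))). split; [apply Rpower_pos |].
    intros eps T He [[? _] | [_ HT]]; [lra |].
    assert (H1 := Hbig eps He).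
    assert (HTk : S * Rpower eps (- (q * (p - 1))) <= Rpower T (- k)).
    { apply Rle_trans with
        (Rpower (Rpower S (/ (- k)) * Rpower eps (- (q * (p - 1) / (- k)))) (- k)).
      - right. rewrite <- Rpower_mult_distr by apply Rpower_pos.
        rewrite !Rpower_mult. f_equal.
        + rewrite Rinv_l by lra. now rewrite Rpower_1.
        + f_equal. field. lra.
      - apply Rpower_le_base; [| lra | lra].
        apply Rmult_lt_0_compat; apply Rpower_pos. }
    assert (HT0 : t0 <= T).
    { destruct (Rle_or_lt t0 T) as [? | Hlt]; [easy |].
      assert (HTpos : 0 < T).
      { apply Rlt_le_trans with (2 := Rge_le _ _ HT).
        apply Rmult_lt_0_compat; apply Rpower_pos. }
      assert (Rpower T (- k) < Rpower t0 (- k)) by (apply Rlt_Rpower_l; lra).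
      assert (0 < - k * D) by nra.
      unfold S in *. nra. }
    split; [easy |]. intros [m [Hm Hineq]].
    assert (HB := blowup_bound p k c (c1 * Rpower eps q) t0 T m
                    (fun t => / (- k) * Rpower t (- k))).
    rewrite Hdelta in HB by lra.
    assert (HB' : (p - 1) * c * (/ - k * Rpower T (- k) - / - k * Rpower t0 (- k))
                  < (p - 1) * c * (D * Rpower eps (- (q * (p - 1))))).
    { apply HB; try lra; try easy.
      - apply Rmult_lt_0_compat; [easy | apply Rpower_pos].
      - intros t Ht.
        replace (Rpower t (- 1 - k)) with (/ (- k) * ((- k) * Rpower t (- k - 1))).
        + apply (is_derive_scal (fun t => Rpower t (- k))).
          now apply is_derive_Rpower.
        + replace (- k - 1) with (- 1 - k) by ring. field. lra. }
    apply Rmult_lt_reg_l in HB'; [| easy].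
    assert (HB'' : Rpower T (- k) - Rpower t0 (- k)
                   < - k * (D * Rpower eps (- (q * (p - 1))))).
    { apply Rmult_lt_reg_l with (/ - k); [now apply Rinv_0_lt_compat |].
      replace (/ - k * (- k * (D * Rpower eps (- (q * (p - 1))))))
        with (D * Rpower eps (- (q * (p - 1)))) by (field; lra).
      lra. }
    unfold S in HTk. generalize (Rpower_pos t0 (- k)). nra.
  - subst k. set (S := ln t0 + D).
    exists S. split; [unfold S; lra |].
    intros eps T He [[_ HT] | [? _]]; [| lra].
    assert (H1 := Hbig eps He).
    assert (HTpos : 0 < T).
    { apply Rlt_le_trans with (2 := Rge_le _ _ HT). apply exp_pos. }
    assert (HTk : S * Rpower eps (- (q * (p - 1))) <= ln T).
    { rewrite <- (ln_exp (S * _)). apply Rcomplements.ln_le; [apply exp_pos | lra]. }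
    assert (HT0 : t0 <= T).
    { destruct (Rle_or_lt t0 T) as [? | Hlt]; [easy |].
      assert (ln T < ln t0) by (apply ln_increasing; lra).
      unfold S in *. nra. }
    split; [easy |]. intros [m [Hm Hineq]].
    assert (HB := blowup_bound p 0 c (c1 * Rpower eps q) t0 T m ln).
    rewrite Hdelta in HB by lra.
    assert (HB' : (p - 1) * c * (ln T - ln t0)
                  < (p - 1) * c * (D * Rpower eps (- (q * (p - 1))))).
    { apply HB; try lra; try easy.
      - apply Rmult_lt_0_compat; [easy | apply Rpower_pos].
      - intros t Ht. replace (Rpower t (- 1 - 0)) with (/ t).
        + now apply is_derive_ln.
        + replace (- 1 - 0) with (Ropp 1) by ring.
          rewrite Rpower_Ropp, Rpower_1; easy. }
    apply Rmult_lt_reg_l in HB'; [| easy].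
    unfold S in HTk. nra.
Qed.

(** * Initial data *)

Lemma eq_0_outside_supp (rho : R) (f : R -> R) :
  (forall x, supp f x -> Rabs x <= rho) ->
  forall x, rho < Rabs x -> f x = 0.
Proof.
  intros Hf x Hx. destruct (Req_dec (f x) 0) as [H | H]; [easy |].
  exfalso. assert (Rabs x <= rho); [| lra].
  apply Hf. intros e. exists x. split; [apply ball_center | easy].
Qed.

Lemma Derive_eq_0_outside (rho : R) (f : R -> R) :
  (forall x, rho < Rabs x -> f x = 0) ->
  forall x, rho < Rabs x -> Derive f x = 0.
Proof.
  intros Hf x Hx.
  rewrite (Derive_ext_loc f (fun _ => 0)); [apply Derive_const |].
  assert (He : 0 < Rabs x - rho) by lra.
  exists (mkposreal _ He). intros y Hy.
  change (Rabs (y - x) < Rabs x - rho) in Hy. apply Hf.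
  generalize (Rabs_triang_inv x y). rewrite Rabs_minus_sym in Hy. lra.
Qed.

Lemma int_line_compact_support (rho : R) (g : R -> R) :
  0 <= rho -> (forall x, continuous g x) ->
  (forall x, rho < Rabs x -> g x = 0) ->
  int_line g = RInt g (- (rho + 1)) (rho + 1).
Proof.
  intros Hr Hg Hg0. unfold int_line. apply is_RInt_gen_unique.
  set (N := rho + 1).
  assert (Hex : forall u w, ex_RInt g u w).
  { intros u w. apply (ex_RInt_continuous (V := R_CompleteNormedModule)).
    intros; apply Hg. }
  assert (Htail : forall u w, (forall x, Rmin u w < x < Rmax u w -> rho < Rabs x) ->
    RInt g u w = 0).
  { intros u w H. rewrite (RInt_ext g (fun _ => 0)).
    - rewrite RInt_const. unfold scal; simpl; unfold mult; simpl. ring.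
    - intros x Hx. apply Hg0, H, Hx. }
  intros P [e HP].
  exists (fun u => u < - N) (fun w => N < w).
  { now exists (- N). } { now exists N. }
  intros u w Hu Hw. exists (RInt g u w). simpl. split.
  { apply (RInt_correct (V := R_CompleteNormedModule)), Hex. }
  apply HP.
  replace (RInt g u w) with (RInt g (- N) N); [apply ball_center |].
  rewrite <- (RInt_Chasles g u (- N) w), <- (RInt_Chasles g (- N) N w) by apply Hex.
  rewrite (Htail u (- N)), (Htail N w).
  - unfold plus; simpl. now rewrite Rplus_0_r, Rplus_0_l.
  - rewrite Rmin_left, Rmax_right by lra. intros x Hx.
    unfold N in Hx. rewrite Rabs_pos_eq; lra.
  - rewrite Rmin_left, Rmax_right by lra. intros x Hx.
    unfold N in Hx. rewrite Rabs_left; lra.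
Qed.

(** [f'] has mean zero, so [int g > 0] forces the profile [g - f'] of the
    right-moving free wave to be positive somewhere, whatever [f] is; by
    continuity it is bounded below on an interval. *)
Lemma profile_pos (rho : R) (f g : R -> R) :
  0 <= rho ->
  (forall x, continuous g x) -> (forall x, rho < Rabs x -> g x = 0) ->
  (forall x, ex_derive f x) -> (forall x, continuous (Derive f) x) ->
  (forall x, rho < Rabs x -> f x = 0) ->
  0 < int_line g ->
  exists c0 s1 s2, 0 < c0 /\ - rho <= s1 < s2 /\ s2 <= rho /\
    forall y, s1 <= y <= s2 -> c0 <= / 2 * (g y - Derive f y).
Proof.
  intros Hr Hg Hg0 Hf Hdf Hf0 Hint.
  set (h := fun y => g y - Derive f y).
  assert (Hdf0 := Derive_eq_0_outside rho f Hf0).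
  assert (Hh : forall y, continuous h y).
  { intros y. now apply (continuous_minus (V := R_NormedModule) g (Derive f)). }
  assert (Hpos : exists y, 0 < h y).
  { destruct (Classical_Prop.classic (exists y, 0 < h y)) as [H | H]; [easy |].
    exfalso.
    rewrite (int_line_compact_support rho) in Hint by easy.
    assert (Hle : RInt g (- (rho + 1)) (rho + 1)
                  <= RInt (Derive f) (- (rho + 1)) (rho + 1)).
    { apply RInt_le.
      - lra.
      - apply (ex_RInt_continuous (V := R_CompleteNormedModule)); intros; apply Hg.
      - apply (ex_RInt_continuous (V := R_CompleteNormedModule)); intros; apply Hdf.
      - intros x _. destruct (Rle_or_lt (g x) (Derive f x)) as [? | Hx]; [easy |].
        exfalso. apply H. exists x. unfold h. lra. }
    rewrite RInt_Derive in Hle by (intros; auto).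
    rewrite (Hf0 (rho + 1)), (Hf0 (- (rho + 1))) in Hle.
    - lra.
    - rewrite Rabs_Ropp, Rabs_pos_eq; lra.
    - rewrite Rabs_pos_eq; lra. }
  destruct Hpos as [y0 Hy0].
  assert (He : 0 < h y0 / 2) by lra.
  destruct (proj1 (filterlim_locally (F := locally y0) h (h y0)) (Hh y0)
              (mkposreal _ He)) as [d Hd].
  assert (Hnear : forall y, Rabs (y - y0) <= d / 2 -> h y0 / 2 <= h y).
  { intros y Hy.
    assert (H : Rabs (h y - h y0) < h y0 / 2).
    { apply (Hd y). change (Rabs (y - y0) < d). generalize (cond_pos d). lra. }
    apply Rabs_def2 in H. lra. }
  assert (Hin : forall y, Rabs (y - y0) <= d / 2 -> Rabs y <= rho).
  { intros y Hy. destruct (Rle_or_lt (Rabs y) rho) as [? | Hlt]; [easy |].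
    assert (H := Hnear y Hy). unfold h at 2 in H.
    rewrite Hg0, Hdf0 in H by easy. lra. }
  generalize (cond_pos d); intros Hdpos.
  exists (h y0 / 4), (y0 - d / 2), (y0 + d / 2). split; [lra |].
  assert (H1 : Rabs (y0 - d / 2) <= rho).
  { apply Hin. apply Rabs_le. lra. }
  assert (H2 : Rabs (y0 + d / 2) <= rho).
  { apply Hin. apply Rabs_le. lra. }
  apply Rabs_le_between in H1. apply Rabs_le_between in H2.
  split; [lra |]. split; [lra |].
  intros y Hy. assert (H := Hnear y). unfold h at 2 in H.
  assert (Rabs (y - y0) <= d / 2) by (apply Rabs_le; lra).
  specialize (H H0). lra.
Qed.

Lemma ut0_rightmoving (rho : R) (f g : R -> R) (x t : R) :
  (forall x, rho < Rabs x -> g x = 0) -> (forall x, rho < Rabs x -> f x = 0) ->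
  rho < x + t -> ut0 f g x t = / 2 * (g (x - t) - Derive f (x - t)).
Proof.
  intros Hg Hf Hx. unfold ut0.
  assert (rho < Rabs (x + t)) by (generalize (Rle_abs (x + t)); lra).
  rewrite Hg, (Derive_eq_0_outside rho f Hf (x + t)) by easy. ring.
Qed.

(** Huygens' principle for the time derivative of the free wave: only the values
    of the data at [x + t] and [x - t] enter, and both points have left the
    supports. *)
Lemma ut0_interior (rho : R) (f g : R -> R) (x t : R) :
  (forall x, rho < Rabs x -> g x = 0) -> (forall x, rho < Rabs x -> f x = 0) ->
  rho < t - Rabs x -> ut0 f g x t = 0.
Proof.
  intros Hg Hf Hx.
  generalize (Rle_abs x) (Rle_abs (- x)); rewrite Rabs_Ropp; intros H1 H2.
  rewrite (ut0_rightmoving rho) by (easy || lra).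
  assert (rho < Rabs (x - t)).
  { rewrite Rabs_minus_sym. generalize (Rle_abs (t - x)); lra. }
  rewrite Hg, (Derive_eq_0_outside rho f Hf (x - t)) by easy. ring.
Qed.

(** * Integrals of nonnegative continuous functions *)

Lemma RInt_const_R (u w c : R) : RInt (fun _ => c) u w = (w - u) * c.
Proof. now rewrite RInt_const. Qed.

Lemma RInt_nonneg_subinterval (h : R -> R) (u u' w' w : R) :
  (forall s, continuous h s) -> (forall s, 0 <= h s) ->
  u <= u' <= w' -> w' <= w -> RInt h u' w' <= RInt h u w.
Proof.
  intros Hh H0 Hu Hw.
  assert (Hex : forall y z, ex_RInt h y z).
  { intros y z. apply (ex_RInt_continuous (V := R_CompleteNormedModule)).
    intros; apply Hh. }
  rewrite <- (RInt_Chasles h u u' w), <- (RInt_Chasles h u' w' w) by apply Hex.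
  unfold plus; simpl.
  assert (0 <= RInt h u u') by (apply RInt_ge_0; [lra | apply Hex | intros; apply H0]).
  assert (0 <= RInt h w' w) by (apply RInt_ge_0; [lra | apply Hex | intros; apply H0]).
  lra.
Qed.

Lemma RInt_nonneg_two_subintervals (h : R -> R) (u s1 s2 s3 w : R) :
  (forall s, continuous h s) -> (forall s, 0 <= h s) ->
  u <= s1 <= s2 -> s2 <= s3 <= w ->
  RInt h s1 s2 + RInt h s3 w <= RInt h u w.
Proof.
  intros Hh H0 Hu Hw.
  assert (Hex : forall y z, ex_RInt h y z).
  { intros y z. apply (ex_RInt_continuous (V := R_CompleteNormedModule)).
    intros; apply Hh. }
  rewrite <- (RInt_Chasles h u s3 w) by apply Hex. unfold plus; simpl.
  generalize (RInt_nonneg_subinterval h u s1 s2 s3 Hh H0 Hu). lra.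
Qed.

(** * The integral equation along characteristics *)

Definition density (p a b : R) (v : R * R -> R) (x s : R) : R :=
  pabs p (v (x, s)) / weight a b x s.

(** Continuity is required on the whole plane, so that the integrals along
    characteristics have integrands continuous up to both ends of the time
    interval. *)
Definition solution (p a b eps T : R) (f g : R -> R) (v : R * R -> R) : Prop :=
  (forall z, continuous v z) /\
  forall x t, 0 <= t <= T ->
    v (x, t) = eps * ut0 f g x t
      + (/ 2 * RInt (fun s => density p a b v (x + t - s) s) 0 t
         + / 2 * RInt (fun s => density p a b v (x - t + s) s) 0 t).

Definition clamp (T t : R) : R := Rmax 0 (Rmin T t).

Lemma clamp_id (T t : R) : 0 <= t <= T -> clamp T t = t.
Proof. intros Ht. unfold clamp. rewrite Rmin_right, Rmax_right; lra. Qed.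

Lemma clamp_range (T t : R) : 0 <= T -> 0 <= clamp T t <= T.
Proof.
  intros HT. unfold clamp, Rmax, Rmin.
  destruct (Rle_dec T t); destruct (Rle_dec 0 _); lra.
Qed.

Lemma clamp_lipschitz (T t t' : R) :
  0 <= T -> Rabs (clamp T t' - clamp T t) <= Rabs (t' - t).
Proof.
  intros HT. generalize (Rle_abs (t' - t)) (Rle_abs (- (t' - t))).
  rewrite Rabs_Ropp. intros H1 H2. generalize (Rabs_pos (t' - t)); intros H3.
  apply Rabs_le. unfold clamp, Rmax, Rmin.
  destruct (Rle_dec T t); destruct (Rle_dec T t'); repeat destruct (Rle_dec 0 _); lra.
Qed.

(** Freezing [v] before time [0] and after time [T] turns continuity relative to
    the strip into continuity on the plane and keeps the equation. *)
Lemma solution_clamp (p a b eps T : R) (f g : R -> R) (v : R * R -> R) :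
  0 <= T -> continuous_on (strip T) v ->
  (forall x t, 0 <= t <= T ->
     v (x, t) = eps * ut0 f g x t + L' a b (fun z => rpow (Rabs (v z)) p) x t) ->
  solution p a b eps T f g (fun z => v (fst z, clamp T (snd z))).
Proof.
  intros HT Hc Heq. split.
  - intros z.
    assert (Hz : strip T (fst z, clamp T (snd z))) by now apply clamp_range.
    apply filterlim_comp with (2 := Hc _ Hz).
    intros P [e HP]. exists e. intros y [Hy1 Hy2].
    apply HP; [| now apply clamp_range].
    split; [exact Hy1 |].
    apply Rle_lt_trans with (2 := Hy2). now apply clamp_lipschitz.
  - intros x t Ht. unfold density; simpl. rewrite clamp_id by easy.
    rewrite (Heq x t Ht). unfold L', pabs.
    do 3 f_equal; apply RInt_ext; rewrite Rmin_left, Rmax_right by lra;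
      intros s Hs; rewrite clamp_id by lra; reflexivity.
Qed.

Lemma density_ge0 (p a b : R) (v : R * R -> R) (x s : R) :
  0 <= density p a b v x s.
Proof.
  unfold density. apply Rmult_le_pos; [apply pabs_ge0 |].
  left. apply Rinv_0_lt_compat, weight_pos.
Qed.

Lemma density_ge (p a b W y : R) (v : R * R -> R) (x s : R) :
  weight a b x s <= W -> y <= pabs p (v (x, s)) -> 0 <= y ->
  y * / W <= density p a b v x s.
Proof.
  intros HW Hy H0. unfold density.
  assert (Hw := weight_pos a b x s).
  apply Rmult_le_compat; [easy | | easy |].
  - left; apply Rinv_0_lt_compat; lra.
  - apply Rinv_le_contravar; lra.
Qed.

Lemma continuous_along (v : R * R -> R) (X : R -> R) (s : R) :
  (forall z, continuous v z) -> continuous X s ->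
  continuous (fun s => v (X s, s)) s.
Proof.
  intros Hv HX.
  apply (continuous_comp_2 X (fun s => s) (fun x s => v (x, s))); [easy | apply continuous_id |].
  apply (continuous_ext v); [now intros [? ?] | apply Hv].
Qed.

Lemma continuous_density_along (p a b : R) (v : R * R -> R) (X : R -> R) (s : R) :
  0 < p -> (forall z, continuous v z) -> continuous X s ->
  continuous (fun s => density p a b v (X s) s) s.
Proof.
  intros Hp Hv HX. unfold density.
  apply (continuous_mult (K := R_AbsRing) (fun s => pabs p (v (X s, s)))
           (fun s => / weight a b (X s) s)).
  - apply (continuous_comp (fun s => v (X s, s)) (pabs p)).
    + now apply continuous_along.
    + now apply continuous_pabs.
  - apply (continuous_Rinv_comp (fun s => weight a b (X s) s)).
    + apply (continuous_along (fun z => weight a b (fst z) (snd z))); [| easy].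
      intros z. apply continuous_weight.
    + apply Rgt_not_eq, weight_pos.
Qed.

Lemma continuous_incoming (p a b : R) (v : R * R -> R) (y s : R) :
  0 < p -> (forall z, continuous v z) ->
  continuous (fun s => density p a b v (y - s) s) s.
Proof.
  intros Hp Hv. apply (continuous_density_along p a b v (fun s => y - s)); try easy.
  apply (ex_derive_continuous (fun s => y - s)). auto_derive. easy.
Qed.

Lemma continuous_outgoing (p a b : R) (v : R * R -> R) (y s : R) :
  0 < p -> (forall z, continuous v z) ->
  continuous (fun s => density p a b v (y + s) s) s.
Proof.
  intros Hp Hv. apply (continuous_density_along p a b v (fun s => y + s)); try easy.
  apply (ex_derive_continuous (fun s => y + s)). auto_derive. easy.
Qed.

Lemma incoming_mono (p a b : R) (v : R * R -> R) (y t' t : R) :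
  0 < p -> (forall z, continuous v z) -> 0 <= t' <= t ->
  RInt (fun s => density p a b v (y - s) s) 0 t'
  <= RInt (fun s => density p a b v (y - s) s) 0 t.
Proof.
  intros Hp Hv Ht. apply RInt_nonneg_subinterval; try lra.
  - intros s. now apply continuous_incoming.
  - intros s. apply density_ge0.
Qed.

Lemma outgoing_mono (p a b : R) (v : R * R -> R) (y t' t : R) :
  0 < p -> (forall z, continuous v z) -> 0 <= t' <= t ->
  RInt (fun s => density p a b v (y + s) s) 0 t'
  <= RInt (fun s => density p a b v (y + s) s) 0 t.
Proof.
  intros Hp Hv Ht. apply RInt_nonneg_subinterval; try lra.
  - intros s. now apply continuous_outgoing.
  - intros s. apply density_ge0.
Qed.

Lemma incoming_ge0 (p a b : R) (v : R * R -> R) (y t : R) :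
  0 < p -> (forall z, continuous v z) -> 0 <= t ->
  0 <= RInt (fun s => density p a b v (y - s) s) 0 t.
Proof.
  intros Hp Hv Ht.
  assert (H := incoming_mono p a b v y 0 t Hp Hv (conj (Rle_refl 0) Ht)).
  rewrite RInt_point in H. exact H.
Qed.

Lemma outgoing_ge0 (p a b : R) (v : R * R -> R) (y t : R) :
  0 < p -> (forall z, continuous v z) -> 0 <= t ->
  0 <= RInt (fun s => density p a b v (y + s) s) 0 t.
Proof.
  intros Hp Hv Ht.
  assert (H := outgoing_mono p a b v y 0 t Hp Hv (conj (Rle_refl 0) Ht)).
  rewrite RInt_point in H. exact H.
Qed.

Lemma solution_ge_free (p a b eps T : R) (f g : R -> R) (v : R * R -> R) (x t : R) :
  0 < p -> solution p a b eps T f g v -> 0 <= t <= T ->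
  eps * ut0 f g x t <= v (x, t).
Proof.
  intros Hp [Hv Heq] Ht. rewrite Heq by easy.
  generalize (incoming_ge0 p a b v (x + t) t Hp Hv (proj1 Ht))
    (outgoing_ge0 p a b v (x - t) t Hp Hv (proj1 Ht)). lra.
Qed.

(** On the outgoing characteristic [x - t = y], which stays within distance
    [rho] of the light cone, the weight is comparable to [t ^ (1 + a)] and the free wave keeps the
    amplitude of its profile at [y]. *)
Lemma characteristic_inequality (p a b rho c0 y : R) (f g : R -> R) :
  1 < p -> 1 <= rho ->
  (forall x, rho < Rabs x -> g x = 0) -> (forall x, rho < Rabs x -> f x = 0) ->
  Rabs y <= rho -> c0 <= / 2 * (g y - Derive f y) ->
  exists c, 0 < c /\ forall eps T v, 0 < eps -> solution p a b eps T f g v ->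
    forall t, rho + 1 <= t <= T ->
      c0 * eps
      + c * RInt (fun s => pabs p (v (y + s, s)) * Rpower s (- 1 - a)) (rho + 1) t
      <= v (y + t, t).
Proof.
  intros Hp Hr Hg Hf Hy Hc0.
  set (K := Rpower 3 (Rabs (1 + a)) * Rpower (rho + 2) (Rabs (1 + b))
            * Rpower 3 (Rabs (1 + a))).
  assert (HK : 0 < K) by (repeat apply Rmult_lt_0_compat; apply Rpower_pos).
  exists (/ 2 * / K). split.
  { apply Rmult_lt_0_compat; [lra | now apply Rinv_0_lt_compat]. }
  intros eps T v Heps Hsol t Ht. destruct Hsol as [Hv Heq].
  assert (Hy' := Hy). apply Rabs_le_between in Hy'.
  rewrite Heq by lra.
  rewrite (ut0_rightmoving rho) by (easy || lra).
  replace (y + t - t) with y by ring.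
  assert (H1 := incoming_ge0 p a b v (y + t + t) t ltac:(lra) Hv ltac:(lra)).
  assert (H2 : RInt (fun s => density p a b v (y + s) s) (rho + 1) t
               <= RInt (fun s => density p a b v (y + s) s) 0 t).
  { apply RInt_nonneg_subinterval; try lra.
    - intros s. apply continuous_outgoing; [lra | easy].
    - intros s. apply density_ge0. }
  assert (Hint : forall s, 0 < s ->
    continuous (fun s => pabs p (v (y + s, s)) * Rpower s (- 1 - a)) s).
  { intros s Hs.
    apply (continuous_mult (K := R_AbsRing) (fun s => pabs p (v (y + s, s)))).
    - apply (continuous_comp (fun s => v (y + s, s)) (pabs p)).
      + apply (continuous_along v (fun s => y + s)); [easy |].
        apply (ex_derive_continuous (fun s => y + s)). auto_derive. easy.
      + apply continuous_pabs. lra.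
    - now apply continuous_Rpower_l. }
  assert (Hex : ex_RInt (fun s => pabs p (v (y + s, s)) * Rpower s (- 1 - a))
                  (rho + 1) t).
  { apply (ex_RInt_continuous (V := R_CompleteNormedModule)).
    rewrite Rmin_left, Rmax_right by lra. intros s Hs. apply Hint. lra. }
  assert (H3 : / K * RInt (fun s => pabs p (v (y + s, s)) * Rpower s (- 1 - a)) (rho + 1) t
               <= RInt (fun s => density p a b v (y + s) s) (rho + 1) t).
  { replace (/ K * RInt _ (rho + 1) t)
      with (RInt (fun s => scal (/ K) (pabs p (v (y + s, s)) * Rpower s (- 1 - a)))
              (rho + 1) t) by (apply (RInt_scal (V := R_CompleteNormedModule)); easy).
    apply RInt_le.
    - lra.
    - now apply (ex_RInt_scal (V := R_NormedModule)).
    - apply (ex_RInt_continuous (V := R_CompleteNormedModule)).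
      intros s _. apply continuous_outgoing; [lra | easy].
    - intros s Hs.
      assert (HW : weight a b (y + s) s <= K * Rpower s (1 + a)).
      { assert (Hx : Rabs (y + s) = y + s) by (apply Rabs_pos_eq; lra).
        apply Rle_trans with (1 := weight_cone_le a b rho (y + s) s
          ltac:(lra) ltac:(lra) ltac:(rewrite Hx; lra)
          ltac:(rewrite Hx; apply Rabs_le; lra)).
        rewrite Hx. unfold K. rewrite !Rmult_assoc.
        do 2 (apply Rmult_le_compat_l; [left; apply Rpower_pos |]).
        apply Rpower_le_comparable; lra. }
      apply Rle_trans with (2 := density_ge p a b _ _ v (y + s) s HW
                              (Rle_refl _) (pabs_ge0 _ _)).
      right. change scal with Rmult.
      replace (- 1 - a) with (- (1 + a)) by ring. rewrite Rpower_Ropp.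
      field. split; [apply Rgt_not_eq, Rpower_pos | lra]. }
  rewrite Rmult_assoc. nra.
Qed.

(** Inside the cone the free wave is gone, and the outgoing (incoming)
    characteristic that ends at [(0, s - x)] is an initial piece of the one that
    ends at [(x, s)] (at [(- x, s)]). *)
Lemma axis_le_interior (p a b rho eps T : R) (f g : R -> R) (v : R * R -> R)
    (x s : R) :
  1 < p -> 0 <= rho ->
  (forall x, rho < Rabs x -> g x = 0) -> (forall x, rho < Rabs x -> f x = 0) ->
  solution p a b eps T f g v ->
  0 <= x -> rho < s - x -> s <= T ->
  0 <= v (x, s) /\ 0 <= v (- x, s) /\ 0 <= v (0, s - x) <= v (x, s) + v (- x, s).
Proof.
  intros Hp Hr Hg Hf [Hv Heq] Hx Hs HT.
  assert (Hp0 : 0 < p) by lra.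
  rewrite !Heq by lra.
  rewrite !(ut0_interior rho f g) by
    (easy || rewrite ?Rabs_Ropp, ?Rabs_R0, ?(Rabs_pos_eq x); lra).
  assert (A1 := incoming_mono p a b v (0 + (s - x)) (s - x) s Hp0 Hv ltac:(lra)).
  assert (A2 := outgoing_mono p a b v (0 - (s - x)) (s - x) s Hp0 Hv ltac:(lra)).
  replace (x - s) with (0 - (s - x)) by ring.
  replace (- x + s) with (0 + (s - x)) by ring.
  generalize (incoming_ge0 p a b v (0 + (s - x)) (s - x) Hp0 Hv ltac:(lra))
    (outgoing_ge0 p a b v (0 - (s - x)) (s - x) Hp0 Hv ltac:(lra))
    (incoming_ge0 p a b v (x + s) s Hp0 Hv ltac:(lra))
    (outgoing_ge0 p a b v (- x - s) s Hp0 Hv ltac:(lra)).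
  lra.
Qed.

(** The rescaling by [t^(1+a)] removes the common factor of the weight on both
    characteristics that end at [(0, t)].  On the right it turns
    [|v|^p s^(-(1+b))] into [|m|^p s^(-1-p(1+a)-b)], whence the exponent.  The
    starting time [rho + 1] ensures that [(0, t)] has left the support of the free
    wave and that [s - |x| >= 1], where the brackets are comparable to their
    arguments. *)
Lemma axis_inequality (p a b rho c0 y1 y2 : R) (f g : R -> R) :
  1 < p -> 1 <= rho ->
  (forall x, rho < Rabs x -> g x = 0) -> (forall x, rho < Rabs x -> f x = 0) ->
  0 < c0 -> - rho <= y1 < y2 -> y2 <= rho ->
  (forall y, y1 <= y <= y2 -> c0 <= / 2 * (g y - Derive f y)) ->
  exists c1 c, 0 < c1 /\ 0 < c /\
    forall eps T v, 0 < eps -> solution p a b eps T f g v ->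
    forall t, rho + 1 <= t <= T ->
      c1 * Rpower eps p
      + c * RInt (fun s => pabs p (Rpower s (1 + a) * v (0, s))
                           * Rpower s (- 1 - (p * (1 + a) + b))) (rho + 1) t
      <= Rpower t (1 + a) * v (0, t).
Proof.
  intros Hp Hr Hg Hf Hc0 Hy1 Hy2 Hprof.
  set (K1 := Rpower 3 (Rabs (1 + a)) * Rpower (rho + 2) (Rabs (1 + b))).
  set (K2 := Rpower 3 (Rabs (1 + a)) * Rpower 3 (Rabs (1 + b))).
  assert (HK1 : 0 < K1) by (apply Rmult_lt_0_compat; apply Rpower_pos).
  assert (HK2 : 0 < K2) by (apply Rmult_lt_0_compat; apply Rpower_pos).
  assert (H2p : 0 < Rpower 2 p) by apply Rpower_pos.
  exists (/ 2 * ((y2 - y1) / 2) * Rpower c0 p * / K1),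
    (/ 2 * / 2 * / Rpower 2 p * / K2).
  split.
  { repeat apply Rmult_lt_0_compat; try lra; [apply Rpower_pos |].
    now apply Rinv_0_lt_compat. }
  split.
  { repeat apply Rmult_lt_0_compat; try lra; now apply Rinv_0_lt_compat. }
  intros eps T v Heps Hsol t Ht. destruct (Hsol) as [Hv Heq].
  assert (Hp0 : 0 < p) by lra.
  assert (Hta : 0 < Rpower t (1 + a)) by apply Rpower_pos.
  set (E := fun s => pabs p (v (0, s)) * Rpower s (- (1 + b))).
  assert (HE : RInt (fun s => pabs p (Rpower s (1 + a) * v (0, s))
                           * Rpower s (- 1 - (p * (1 + a) + b))) (rho + 1) t
               = RInt E (rho + 1) t).
  { apply RInt_ext. rewrite Rmin_left, Rmax_right by lra. intros s Hs.
    assert (Hvs : 0 <= v (0, s)).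
    { generalize (axis_le_interior p a b rho eps T f g v 0 s Hp ltac:(lra) Hg Hf Hsol
                    ltac:(lra) ltac:(lra) ltac:(lra)). tauto. }
    rewrite pabs_mult by (easy || apply Rpower_pos).
    rewrite Rpower_mult. unfold E.
    replace (- (1 + b)) with ((1 + a) * p + (- 1 - (p * (1 + a) + b))) by ring.
    rewrite Rpower_plus. apply Rminus_diag_uniq. ring. }
  rewrite HE.
  assert (HEc : forall s, 0 < s -> continuous E s).
  { intros s Hs.
    apply (continuous_mult (K := R_AbsRing) (fun s => pabs p (v (0, s)))).
    - apply (continuous_comp (fun s => v (0, s)) (pabs p)).
      + apply (continuous_along v (fun _ => 0)); [easy | apply continuous_const].
      + now apply continuous_pabs.
    - now apply continuous_Rpower_l. }
  set (q := fun s => density p a b v (0 + t - s) s + density p a b v (0 - t + s) s).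
  assert (Hqc : forall s, continuous q s).
  { intros s. apply (continuous_plus (V := R_NormedModule)
      (fun s => density p a b v (0 + t - s) s)
      (fun s => density p a b v (0 - t + s) s)).
    - now apply continuous_incoming.
    - now apply continuous_outgoing. }
  assert (Hq0 : forall s, 0 <= q s).
  { intros s. generalize (density_ge0 p a b v (0 + t - s) s)
      (density_ge0 p a b v (0 - t + s) s). unfold q. lra. }
  assert (Hqex : forall u w, ex_RInt q u w).
  { intros u w. apply (ex_RInt_continuous (V := R_CompleteNormedModule)).
    intros; apply Hqc. }
  assert (Hvq : v (0, t) = / 2 * RInt q 0 t).
  { rewrite Heq by lra.
    rewrite (ut0_interior rho f g) by (easy || rewrite Rabs_R0; lra).
    unfold q.
    rewrite (RInt_plus (V := R_CompleteNormedModule)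
      (fun s => density p a b v (0 + t - s) s)
      (fun s => density p a b v (0 - t + s) s)).
    - change plus with Rplus. ring.
    - apply (ex_RInt_continuous (V := R_CompleteNormedModule)).
      intros s _. now apply continuous_incoming.
    - apply (ex_RInt_continuous (V := R_CompleteNormedModule)).
      intros s _. now apply continuous_outgoing. }
  assert (Hmirror : forall s, weight a b (0 - t + s) s = weight a b (0 + t - s) s).
  { intros s. rewrite <- weight_even. f_equal. ring. }
  (* times at which the incoming characteristic meets [y1 <= x - s <= y2]; there
     the free wave alone bounds [v] from below *)
  assert (Hstrip : (y2 - y1) / 2 * (Rpower c0 p * Rpower eps p
                     * / (K1 * Rpower t (1 + a)))
                   <= RInt q ((t - y2) / 2) ((t - y1) / 2)).
  { replace ((y2 - y1) / 2 * _) with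
      (RInt (fun _ => Rpower c0 p * Rpower eps p * / (K1 * Rpower t (1 + a)))
         ((t - y2) / 2) ((t - y1) / 2)).
    2: { rewrite RInt_const_R. f_equal. field. }
    apply RInt_le; [lra | apply ex_RInt_const | apply Hqex |].
    intros s Hs.
    assert (Hx : Rabs (0 + t - s) = t - s).
    { rewrite Rabs_pos_eq; lra. }
    assert (Hd : Rpower c0 p * Rpower eps p * / (K1 * Rpower t (1 + a))
                 <= density p a b v (0 + t - s) s).
    { apply density_ge.
      - replace (Rpower t (1 + a)) with (Rpower (s + Rabs (0 + t - s)) (1 + a)).
        + apply weight_cone_le; rewrite ?Hx; try lra. apply Rabs_le; lra.
        + f_equal. rewrite Hx. ring.
      - rewrite Rpower_mult_distr by lra. rewrite <- pabs_pos by nra.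
        apply pabs_le; [lra | nra |].
        apply Rle_trans with (eps * ut0 f g (0 + t - s) s).
        + rewrite (ut0_rightmoving rho) by (easy || lra).
          rewrite Rmult_comm. apply Rmult_le_compat_l; [lra |].
          apply Hprof. lra.
        + apply (solution_ge_free p a b eps T); [easy | easy | lra].
      - apply Rmult_le_pos; left; apply Rpower_pos. }
    generalize (density_ge0 p a b v (0 - t + s) s). unfold q. lra. }
  (* times with [s - (t - s) >= rho + 1]: there [v] is compared with its value on
     the axis at the earlier time [2 s - t] *)
  assert (Hinner : / 2 * (/ Rpower 2 p * / (K2 * Rpower t (1 + a)))
                     * RInt E (rho + 1) t
                   <= RInt q ((t + (rho + 1)) / 2) t).
  { set (A := / Rpower 2 p * / (K2 * Rpower t (1 + a))).
    assert (Hcv : RInt E (rho + 1) t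
      = RInt (fun s => scal 2 (E (2 * s + - t))) ((t + (rho + 1)) / 2) t).
    { rewrite (RInt_comp_lin (V := R_CompleteNormedModule)).
      - f_equal; field.
      - apply (ex_RInt_continuous (V := R_CompleteNormedModule)).
        rewrite Rmin_left, Rmax_right by lra. intros s Hs. apply HEc. lra. }
    assert (Hexc : ex_RInt (fun s => scal 2 (E (2 * s + - t)))
                     ((t + (rho + 1)) / 2) t).
    { apply (ex_RInt_comp_lin (V := R_NormedModule)).
      apply (ex_RInt_continuous (V := R_CompleteNormedModule)).
      rewrite Rmin_left, Rmax_right by lra. intros s Hs. apply HEc. lra. }
    rewrite Hcv.
    replace (/ 2 * A * RInt _ _ t) with
      (RInt (fun s => scal (/ 2 * A) (scal 2 (E (2 * s + - t))))
         ((t + (rho + 1)) / 2) t)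
      by (apply (RInt_scal (V := R_CompleteNormedModule)); easy).
    apply RInt_le; [lra | | apply Hqex |].
    { now apply (ex_RInt_scal (V := R_NormedModule)). }
    intros s Hs.
    assert (Hx : Rabs (0 + t - s) = t - s).
    { rewrite Rabs_pos_eq; lra. }
    destruct (axis_le_interior p a b rho eps T f g v (0 + t - s) s Hp ltac:(lra)
                Hg Hf Hsol ltac:(lra) ltac:(lra) ltac:(lra)) as [B1 [B2 B3]].
    replace (- (0 + t - s)) with (0 - t + s) in * by ring.
    replace (s - (0 + t - s)) with (2 * s + - t) in * by ring.
    set (beta := 2 * s + - t) in *.
    set (W := K2 * (Rpower t (1 + a) * Rpower beta (1 + b))).
    assert (HW : weight a b (0 + t - s) s <= W).
    { assert (H := weight_interior_le a b (0 + t - s) s).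
      rewrite Hx in H. replace (s + (t - s)) with t in H by ring.
      replace (s - (t - s)) with beta in H by (unfold beta; ring).
      apply H. unfold beta; lra. }
    assert (D1 := density_ge p a b W _ v (0 + t - s) s HW (Rle_refl _) (pabs_ge0 _ _)).
    assert (HW' := HW). rewrite <- Hmirror in HW'.
    assert (D2 := density_ge p a b W _ v (0 - t + s) s HW' (Rle_refl _) (pabs_ge0 _ _)).
    assert (HWpos : 0 < / W).
    { apply Rinv_0_lt_compat. apply Rmult_lt_0_compat; [easy |].
      apply Rmult_lt_0_compat; apply Rpower_pos. }
    assert (Hsum : pabs p (v (0, beta))
      <= Rpower 2 p * (pabs p (v (0 + t - s, s)) + pabs p (v (0 - t + s, s)))).
    { apply Rle_trans with (pabs p (v (0 + t - s, s) + v (0 - t + s, s))).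
      - apply pabs_le; lra.
      - apply pabs_plus; lra. }
    apply Rle_trans with (/ Rpower 2 p * pabs p (v (0, beta)) * / W).
    { right. change scal with Rmult. cbv beta. unfold E, A, W.
      rewrite Rpower_Ropp. field.
      repeat split; apply Rgt_not_eq; try easy; apply Rpower_pos. }
    apply Rle_trans with
      ((pabs p (v (0 + t - s, s)) + pabs p (v (0 - t + s, s))) * / W).
    { apply Rmult_le_compat_r; [lra |].
      apply Rmult_le_reg_l with (Rpower 2 p); [easy |].
      rewrite <- Rmult_assoc, Rinv_r, Rmult_1_l by lra. easy. }
    unfold q. lra. }
  assert (Htwo := RInt_nonneg_two_subintervals q 0 ((t - y2) / 2) ((t - y1) / 2)
                    ((t + (rho + 1)) / 2) t Hqc Hq0 ltac:(lra) ltac:(lra)).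
  rewrite Hvq.
  apply Rle_trans with (Rpower t (1 + a) * (/ 2 *
    ((y2 - y1) / 2 * (Rpower c0 p * Rpower eps p * / (K1 * Rpower t (1 + a)))
     + / 2 * (/ Rpower 2 p * / (K2 * Rpower t (1 + a))) * RInt E (rho + 1) t))).
  { right. field. repeat split; lra. }
  apply Rmult_le_compat_l; lra.
Qed.

Theorem theorem2p2 :
  forall (p a b rho : R) (g : R -> R),
    1 < p -> 1 <= rho ->
    C0_k 1 g ->
    (forall x : R, supp g x -> Rabs x <= rho) ->
    0 < int_line g ->
    exists eps2 : R, 0 < eps2 /\
    forall f : R -> R,
      C0_k 2 f ->
      (forall x : R, supp f x -> Rabs x <= rho) ->
      exists C : R, 0 < C /\
      forall eps T : R,
        0 < eps <= eps2 ->
        (   (a = 0 /\ b >= - p /\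
             T >= exp (C * Rpower eps (- (p - 1))))
         \/ (a > 0 /\ p * (1 + a) + b = 0 /\
             T >= exp (C * Rpower eps (- (p * (p - 1)))))
         \/ (a < 0 /\ b >= - p /\
             T >= C * Rpower eps (- ((p - 1) / (- a))))
         \/ (p * (1 + a) + b < 0 /\ b < - p /\
             T >= C * Rpower eps (- (p * (p - 1) / (- p * (1 + a) - b))))) ->
        ~ exists v : R * R -> R,
            continuous_on (strip T) v /\
            (forall x t : R, supp_on (strip T) v (x, t) -> Rabs x <= t + rho) /\
            (forall x t : R, 0 <= t <= T ->
               v (x, t) = eps * ut0 f g x t
                          + L' a b (fun z => rpow (Rabs (v z)) p) x t).
Proof.
  intros p a b rho g Hp Hr Hg Hgs Hint.
  exists 1. split; [lra |]. intros f Hf Hfs.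
  assert (Hg0 := eq_0_outside_supp rho g Hgs).
  assert (Hf0 := eq_0_outside_supp rho f Hfs).
  destruct (profile_pos rho f g) as [c0 [y1 [y2 [Hc0 [Hy1 [Hy2 Hprof]]]]]];
    try easy; try lra.
  { intros x. apply (proj1 Hg 0%nat). apply le_0_n. }
  { intros x. apply (proj1 Hf 1%nat). apply le_n_S, le_0_n. }
  { intros x. apply (proj1 Hf 1%nat). apply le_n_S, le_0_n. }
  assert (Hc1 := characteristic_inequality p a b rho c0 y1 f g Hp Hr Hg0 Hf0
            ltac:(apply Rabs_le; lra) (Hprof y1 ltac:(lra))).
  destruct Hc1 as [c [Hc Hchar]].
  destruct (axis_inequality p a b rho c0 y1 y2 f g Hp Hr Hg0 Hf0 Hc0 Hy1 Hy2 Hprof)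
    as [d1 [d [Hd1 [Hd Haxis]]]].
  set (kappa := p * (1 + a) + b) in *.
  (* [a] or [kappa] may be positive; the constant attached to that exponent is
     then arbitrary, which lets one [C] be chosen before the case split *)
  assert (Hlife : forall k q e1 e, 0 <= q -> 0 < e1 -> 0 < e -> exists C, 0 < C /\
    (k <= 0 -> forall eps T, 0 < eps <= 1 ->
    (k = 0 /\ T >= exp (C * Rpower eps (- (q * (p - 1)))))
    \/ (k < 0 /\ T >= C * Rpower eps (- (q * (p - 1) / (- k)))) ->
    rho + 1 <= T /\
    ~ exists m : R -> R,
        (forall t, 0 < t -> continuous m t) /\
        (forall t, rho + 1 <= t <= T ->
           e1 * Rpower eps q
           + e * RInt (fun s => pabs p (m s) * Rpower s (- 1 - k)) (rho + 1) t
           <= m t))).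
  { intros k q e1 e Hq He1 He. destruct (Rle_or_lt k 0) as [Hk | Hk].
    - destruct (lifespan_bound p k q e1 e (rho + 1)) as [C [HC HL]]; try lra.
      now exists C.
    - exists 1. split; [lra | intros; lra]. }
  destruct (Hlife a 1 c0 c) as [Ca [HCa HLa]]; try lra.
  destruct (Hlife kappa p d1 d) as [Ck [HCk HLk]]; try lra.
  exists (Rmax Ca Ck).
  assert (HmaxA := Rmax_l Ca Ck). assert (HmaxK := Rmax_r Ca Ck).
  split; [lra |].
  intros eps T Heps HT [v [Hv [_ Heq]]].
  assert (Hexp : forall C C' y, C <= C' ->
            exp (C * Rpower eps y) <= exp (C' * Rpower eps y)).
  { intros C C' y HCC. assert (H := Rpower_pos eps y).
    destruct (Rle_lt_or_eq_dec _ _ HCC) as [Hlt | ->]; [| lra].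
    left. apply exp_increasing. nra. }
  assert (Hmul : forall C C' y, C <= C' -> C * Rpower eps y <= C' * Rpower eps y).
  { intros C C' y HCC. apply Rmult_le_compat_r; [left; apply Rpower_pos | easy]. }
  assert (Hmech :
    (a <= 0 /\ ((a = 0 /\ T >= exp (Ca * Rpower eps (- (1 * (p - 1)))))
     \/ (a < 0 /\ T >= Ca * Rpower eps (- (1 * (p - 1) / (- a))))))
    \/ (kappa <= 0 /\ ((kappa = 0 /\ T >= exp (Ck * Rpower eps (- (p * (p - 1)))))
     \/ (kappa < 0 /\ T >= Ck * Rpower eps (- (p * (p - 1) / (- kappa))))))).
  { rewrite !(Rmult_1_l (p - 1)).
    destruct HT as [[Ha [_ HT]] | [[_ [Hk HT]] | [[Ha [_ HT]] | [Hk [_ HT]]]]].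
    - left. split; [lra |]. left. split; [easy |].
      generalize (Hexp _ _ (- (p - 1)) HmaxA). lra.
    - right. split; [lra |]. left. split; [easy |].
      generalize (Hexp _ _ (- (p * (p - 1))) HmaxK). lra.
    - left. split; [lra |]. right. split; [easy |].
      generalize (Hmul _ _ (- ((p - 1) / - a)) HmaxA). lra.
    - right. split; [lra |]. right. split; [easy |].
      replace (- p * (1 + a) - b) with (- kappa) in HT by (unfold kappa; ring).
      generalize (Hmul _ _ (- (p * (p - 1) / - kappa)) HmaxK). lra. }
  set (w := fun z : R * R => v (fst z, clamp T (snd z))).
  destruct Hmech as [[Ha HTa] | [Hk HTk]].
  - destruct (HLa Ha eps T Heps HTa) as [HT0 Hno]. apply Hno.
    assert (Hsol : solution p a b eps T f g w) by (apply solution_clamp; [lra | easy | easy]).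
    exists (fun t => w (y1 + t, t)). split.
    + intros t _. apply (continuous_along w (fun t => y1 + t)); [apply Hsol |].
      apply (ex_derive_continuous (fun s => y1 + s)). auto_derive. easy.
    + intros t Ht. rewrite Rpower_1 by lra.
      apply (Hchar eps T w); [lra | easy | easy].
  - destruct (HLk Hk eps T Heps HTk) as [HT0 Hno]. apply Hno.
    assert (Hsol : solution p a b eps T f g w) by (apply solution_clamp; [lra | easy | easy]).
    exists (fun t => Rpower t (1 + a) * w (0, t)). split.
    + intros t Ht.
      apply (continuous_mult (K := R_AbsRing) (fun t => Rpower t (1 + a))).
      * now apply continuous_Rpower_l.
      * apply (continuous_along w (fun _ => 0)); [apply Hsol | apply continuous_const].
    + intros t Ht. apply (Haxis eps T w); [lra | easy | easy].
Qed.
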